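(* Let $X$ and $Y$ be spectral topological spaces and let $f\colon X\to Y$ be a continuous map. Then $f$ induces a bijection $\mathrm{OC}(Y)\xrightarrow{\sim}\mathrm{OC}(X)$, $V\mapsto f^{-1}(V)$, if and only if $\pi_0(f)\colon\pi_0(X)\to\pi_0(Y)$ is bijective.
   Context: For a topological space $X$, $\mathrm{OC}(X)$ denotes the set of subsets of $X$ that are both open and closed, and $\pi_0(X)$ denotes the set of connected components of $X$. For a continuous map $f\colon X\to Y$, the map $\pi_0(f)$ sends a connected component $C$ of $X$ to the unique connected component of $Y$ containing $f(C)$. The map $f$ is only assumed to be continuous (not necessarily spectral). *)

(* Defs.v *)
From HB Require Import structures.
From mathcomp Require Import all_boot all_order.
From mathcomp Require Import all_classical topology.

Set Implicit Arguments.
Unset Strict Implicit.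
Unset Printing Implicit Defensive.

Local Open Scope classical_set_scope.

Definition irreducible (X : topologicalType) (Z : set X) : Prop :=
  Z !=set0 /\
  forall A B : set X, closed A -> closed B -> Z `<=` A `|` B ->
    Z `<=` A \/ Z `<=` B.

Definition sober (X : topologicalType) : Prop :=
  forall Z : set X, closed Z -> irreducible Z ->
    exists! x : X, closure [set x] = Z.

(* [compact] involves no separation axiom: it is quasi-compactness. *)
Definition spectral (X : topologicalType) : Prop :=
  [/\ compact [set: X],
      basis [set U : set X | open U /\ compact U],
      forall U V : set X, open U -> compact U -> open V -> compact V ->
        compact (U `&` V)
    & sober X].

Definition OC (X : topologicalType) : set (set X) := [set U | clopen U].

Definition pi0 (X : topologicalType) : set (set X) :=
  [set C | exists x : X, C = connected_component [set: X] x].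

(* The default value [set0] of [xget] is irrelevant when [f] is continuous and
   [C] is a connected component, see [pi0_mapP]. *)
Definition pi0_map (X Y : topologicalType) (f : X -> Y) (C : set X) : set Y :=
  xget set0 [set D | pi0 D /\ f @` C `<=` D].

Lemma pi0_exists_unique (X Y : topologicalType) (f : X -> Y) (C : set X) :
  continuous f -> pi0 C -> exists! D : set Y, pi0 D /\ f @` C `<=` D.
Proof.
move=> cf [x ->]; exists (connected_component [set: Y] (f x)); split.
  split; first by exists (f x).
  apply: connected_component_max => //.
    by exists x => //; apply: connected_component_refl.
  apply: connected_continuous_connected; first exact: component_connected.
  exact: continuous_subspaceT.
move=> D [[y ->] sD]; apply/esym/same_connected_component/sD.
by exists x => //; apply: connected_component_refl.
Qed.

Lemma pi0_mapP (X Y : topologicalType) (f : X -> Y) (C : set X) (D : set Y) :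
  continuous f -> pi0 C -> pi0_map f C = D <-> pi0 D /\ f @` C `<=` D.
Proof.
move=> cf pC; have [E [pE uE]] := pi0_exists_unique cf pC.
have pm : pi0 (pi0_map f C) /\ f @` C `<=` pi0_map f C.
  by apply: (@xgetPex _ set0 [set D | pi0 D /\ f @` C `<=` D]); exists E.
by split=> [<- //|/uE <-]; apply/esym/uE.
Qed.

(* Main.v *)
Require Import Defs.
From HB Require Import structures.
From mathcomp Require Import all_boot all_order.
From mathcomp Require Import all_classical topology.

(** In a spectral space the connected component of a point is the intersection
    of its clopen neighbourhoods ([connected_component_clopenP]); this is the
    only place where the compact open sets are used, and it is what lets
    components and clopen sets determine each other. With it, both directions
    are separation arguments, made uniform by quasi-compactness in the form of
    [compact_clopen_avoid]: if each point of a compact set is mapped outside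
    some clopen neighbourhood of [y], then a single one works for all of them.

    If taking preimages is a bijection on clopen sets, two points in different
    components of [X] are separated by a clopen set, which is a preimage, so
    their images are in different components of [Y]; and if [f] missed the
    component of [y], it would miss a clopen neighbourhood [V] of [y], and then
    [V] and the empty set would have the same preimage.

    If [pi0_map f] is bijective, a clopen set of [Y], being a union of
    components that all meet the range of [f], is determined by its preimage.
    A clopen set [U] of [X] is the preimage of the union of the components that
    meet [f @` U]. This union is closed because [U] is compact, and its
    complement is the union obtained from [~` U] in the same way, so it is
    clopen. *)

Local Open Scope classical_set_scope.

(** * Compactness *)

(** This packages the extraction of a finite subcover. If [P K] fails, the sets
    whose complement in [K] satisfies [P] form a proper filter, and a cluster
    point of it has no neighbourhood satisfying [P]. *)
Lemma compact_induction {T : topologicalType} (K : set T) (P : set T -> Prop) :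
  compact K -> P set0 -> (forall A B, A `<=` B -> P B -> P A) ->
  (forall A B, P A -> P B -> P (A `|` B)) ->
  (forall x, K x -> exists2 N, nbhs x N & P N) -> P K.
Proof.
move=> cK P0 PS PU Ploc; apply: contrapT => nPK.
pose F : set_system T := [set A | P (K `\` A)].
have FF : Filter F.
  split=> [|A B FA FB|A B AB FA]; rewrite /F /=.
  - by rewrite setDT.
  - by rewrite setDIr; apply: PU.
  - by apply: PS FA; apply: setDS.
have PF : ProperFilter F.
  apply: Build_ProperFilter_ex => A FA; apply: contrapT => A0.
  by apply: nPK; apply: PS FA => x Kx; split=> // Ax; apply: A0; exists x.
have FK : F K by rewrite /F /= setDv.
have [x [Kx xF]] := cK F PF FK.
have [N xN PN] := Ploc x Kx.
have FN : F (~` N) by apply: PS PN => z [_ /contrapT].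
by have [z [nNz /nNz]] := xF _ _ FN xN.
Qed.

Lemma compactU {T : topologicalType} (A B : set T) :
  compact A -> compact B -> compact (A `|` B).
Proof.
move=> /compact_near_coveringP cA /compact_near_coveringP cB.
apply/compact_near_coveringP => I F P FF PAB.
have PA : \near F, A `<=` P F by apply: cA => x Ax; apply: PAB; left.
have PB : \near F, B `<=` P F by apply: cB => x Bx; apply: PAB; right.
by apply: filterS2 PA PB => i iA iB x [/iA|/iB].
Qed.

Lemma compact_open_between {T : topologicalType} (K O : set T) :
  basis [set U : set T | open U /\ compact U] ->
  compact K -> open O -> K `<=` O ->
  exists U, [/\ open U, compact U, K `<=` U & U `<=` O].
Proof.
move=> [_ bT] cK oO KO.
apply: (compact_induction K
  (fun A => exists U, [/\ open U, compact U, A `<=` U & U `<=` O])) => //.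
- by exists set0; split=> //; [exact: open0 | exact: compact0].
- by move=> A B AB [U [oU cU BU UO]]; exists U; split=> //; apply: subset_trans BU.
- move=> A B [U [oU cU AU UO]] [V [oV cV BV VO]]; exists (U `|` V); split.
  + exact: openU.
  + exact: compactU.
  + exact: setUSS.
  + by rewrite subUset.
- move=> x /KO Ox; have /bT[U [[oU cU] Ux] UO] : nbhs x O by exact: open_nbhs_nbhs.
  by exists U; [exact: open_nbhs_nbhs | exists U; split].
Qed.

(** Finitely many clopen neighbourhoods of [y] can be intersected. *)
Lemma compact_clopen_avoid {X Y : topologicalType} (f : X -> Y) (K : set X)
    (y : Y) :
  continuous f -> compact K ->
  (forall x, K x -> exists Z, [/\ clopen Z, Z y & ~ Z (f x)]) ->
  exists Z, [/\ clopen Z, Z y & forall x, K x -> ~ Z (f x)].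
Proof.
move=> cf cK Kf.
apply: (compact_induction K (fun A => exists Z,
  [/\ clopen Z, Z y & forall x, A x -> ~ Z (f x)])) => //.
- by exists setT; split=> //; exact: clopenT.
- by move=> A B AB [Z [cZ Zy BZ]]; exists Z; split=> // x /AB /BZ.
- move=> A B [Z [cZ Zy AZ]] [W [cW Wy BW]]; exists (Z `&` W); split=> //.
    exact: clopenI.
  by move=> x [/AZ nZ [/nZ]|/BW nW [_ /nW]].
- move=> x /Kf[Z [cZ Zy nZ]]; exists (f @^-1` (~` Z)); last by exists Z; split.
  by apply: open_nbhs_nbhs; split=> //; apply: (preimage_clopen _ cf).1; apply: clopenC.
Qed.

(** * Components and clopen sets *)

Lemma component_sub_clopen {T : topologicalType} (Z : set T) (x : T) :
  clopen Z -> Z x -> connected_component [set: T] x `<=` Z.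
Proof.
move=> [oZ cZ] Zx; set C := connected_component _ x.
have /(_ (C `&` Z)) <- : connected C by exact: component_connected.
- exact: subIsetr.
- by exists x; split=> //; exact: connected_component_refl.
- by exists Z.
- by exists Z.
Qed.

Definition quasi_component {T : topologicalType} (x : T) : set T :=
  [set y | forall Z, clopen Z -> Z x -> Z y].

Lemma quasi_component_closed {T : topologicalType} (x : T) :
  closed (quasi_component x).
Proof.
have -> : quasi_component x = \bigcap_(Z in [set Z | clopen Z /\ Z x]) Z.
  by apply/seteqP; split=> y yx Z; [case; exact: yx | move=> cZ Zx; exact: yx].
by apply: closed_bigI => Z [[]].
Qed.

(** The two pieces of a splitting of the quasi-component [S] of [x] are
    compact, so they lie in compact open sets [U] and [V] whose intersection
    misses [S]. As [U `&` V] and the complement of [U `|` V] are compact, some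
    clopen neighbourhood [Z] of [x] misses both; it is the disjoint union of
    the clopen sets [Z `&` U] and [Z `&` V], and the one containing [x]
    contains [S]. *)
Lemma quasi_component_split {T : topologicalType} (x : T) (O F : set T) :
  spectral T -> open O -> closed F ->
  quasi_component x `&` O = quasi_component x `&` F ->
  O x -> quasi_component x `<=` O.
Proof.
move=> [cT bT cI _] oO cF OF Ox; set S := quasi_component x in OF *.
have Sx : S x by [].
have cS (A : set T) : closed A -> compact (S `&` A).
  move=> clA; rewrite -(setTI (S `&` A)); apply: compact_closedI => //.
  by apply: closedI => //; exact: quasi_component_closed.
have cSO : compact (S `&` O) by rewrite OF; apply: cS.
have SOF z : S z -> O z <-> F z.
  move=> Sz; split=> [Oz|Fz].
    by have [] : (S `&` F) z by rewrite -OF.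
  by have [] : (S `&` O) z by rewrite OF.
have [U [oU cU SU UO]] := compact_open_between _ _ bT cSO oO (@subIsetr _ _ _).
have cSC : compact (S `&` ~` O) by apply: cS; exact: open_closedC.
have SCF : S `&` ~` O `<=` ~` F by move=> z [Sz nOz] /(SOF z Sz).
have [V [oV cV SV VF]] :=
  compact_open_between _ _ bT cSC (closed_openC cF) SCF.
have avoid (K : set T) : compact K -> (forall z, K z -> ~ S z) ->
    exists Z, [/\ clopen Z, Z x & forall z, K z -> ~ Z z].
  move=> cK KS; apply: (compact_clopen_avoid idfun) => // [z|z Kz]; first exact: cvg_id.
  have /existsNP[Z /not_implyP[cZ /not_implyP[Zx nZz]]] := KS z Kz.
  by exists Z; split.
have [Z1 [cZ1 Z1x UVZ]] : exists Z,
    [/\ clopen Z, Z x & forall z, (U `&` V) z -> ~ Z z].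
  apply: avoid; first exact: cI.
  by move=> z [/UO Oz /VF nFz] Sz; apply: nFz; apply/(SOF z Sz).
have [Z2 [cZ2 Z2x ZUV]] : exists Z,
    [/\ clopen Z, Z x & forall z, (~` (U `|` V)) z -> ~ Z z].
  apply: avoid => [|z nUV Sz].
    by rewrite -(setTI (~` _)); apply: compact_closedI => //;
      apply: open_closedC; exact: openU.
  by apply: nUV; case: (pselect (O z)) => Oz; [left; apply: SU | right; apply: SV].
have [oZ clZ] : clopen (Z1 `&` Z2) by exact: clopenI.
have cZU : clopen (Z1 `&` Z2 `&` U).
  split; first exact: openI.
  have -> : Z1 `&` Z2 `&` U = Z1 `&` Z2 `&` ~` V.
    apply/seteqP; split=> z [[z1 z2] zUV]; split=> //.
      by move=> Vz; apply: (UVZ z).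
    by apply: contrapT => nUz; apply: (ZUV z) => // -[].
  by apply: closedI => //; exact: open_closedC.
have Ux : U x by exact: SU.
by move=> z /(_ _ cZU (conj (conj Z1x Z2x) Ux))[_ /UO].
Qed.

(** The quasi-component is connected: of the two pieces of a splitting, the one
    that contains [x] is everything. *)
Lemma connected_component_clopenP {T : topologicalType} (x y : T) :
  spectral T ->
  connected_component [set: T] x y <-> forall Z, clopen Z -> Z x -> Z y.
Proof.
move=> sT; split=> [xy Z cZ Zx|].
  exact: component_sub_clopen cZ Zx y xy.
apply: (connected_component_max (B := quasi_component x)) => //.
move=> B [b Bb] [O oO BO] [F cF BF].
have [Ox|nOx] := pselect (O x).
  have SO := quasi_component_split _ _ _ sT oO cF (etrans (esym BO) BF) Ox.
  by rewrite BO; apply/setIidPl.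
have nFx : ~ F x.
  move=> Fx; apply: nOx.
  by have [] : (quasi_component x `&` O) x by rewrite -BO BF; split.
have FO : quasi_component x `&` ~` F = quasi_component x `&` ~` O.
  rewrite -!setDE -[LHS]set0U -[RHS]set0U -(setDv (quasi_component x)).
  by rewrite -!setDIr -BF -BO.
have SF := quasi_component_split _ _ _ sT (closed_openC cF)
  (open_closedC oO) FO nFx.
by move: Bb; rewrite BF => -[/SF].
Qed.

Lemma not_connected_component_clopen {T : topologicalType} (x y : T) :
  spectral T -> ~ connected_component [set: T] x y ->
  exists Z, [/\ clopen Z, Z x & ~ Z y].
Proof.
move=> sT /(connected_component_clopenP x y sT).
by move=> /existsNP[Z /not_implyP[cZ /not_implyP[Zx nZy]]]; exists Z; split.
Qed.

(** * The map on components *)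

Lemma pi0_map_component {X Y : topologicalType} (f : X -> Y) (x : X) :
  continuous f ->
  pi0_map f (connected_component [set: X] x) =
  connected_component [set: Y] (f x).
Proof.
move=> cf; have pC : pi0 (connected_component [set: X] x) by exists x.
apply/(pi0_mapP _ cf pC); split; first by exists (f x).
apply: connected_component_max => //.
  by exists x => //; exact: connected_component_refl.
apply: connected_continuous_connected; first exact: component_connected.
exact: continuous_subspaceT.
Qed.

Lemma eq_connected_component {T : topologicalType} (x y : T) :
  connected_component [set: T] x = connected_component [set: T] y <->
  connected_component [set: T] x y.
Proof.
split=> [->|]; first exact: connected_component_refl.
exact: same_connected_component.
Qed.

(** Bijectivity of [pi0_map f] in terms of points. *)
Lemma pi0_map_bijP {X Y : topologicalType} (f : X -> Y) : continuous f ->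
  set_bij (@pi0 X) (@pi0 Y) (pi0_map f) <->
  (forall x x', connected_component [set: Y] (f x) (f x') ->
     connected_component [set: X] x x') /\
  (forall y, exists x, connected_component [set: Y] y (f x)).
Proof.
move=> cf; split=> [[_ inj surj]|[inj surj]]; split.
- move=> x x' xx'; apply/eq_connected_component/inj.
  + by rewrite inE; exists x.
  + by rewrite inE; exists x'.
  + by rewrite !pi0_map_component//; apply/eq_connected_component.
- move=> y; have [|_ [x ->]] := surj (connected_component setT y); first by exists y.
  rewrite pi0_map_component// => /esym/eq_connected_component yx.
  by exists x.
- by move=> _ [x ->]; rewrite pi0_map_component//; exists (f x).
- move=> C C'; rewrite !inE => -[x ->] [x' ->].
  rewrite !pi0_map_component// => /eq_connected_component xx'.
  exact/eq_connected_component/inj.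
- move=> _ [y ->]; have [x yx] := surj y.
  exists (connected_component setT x); first by exists x.
  by rewrite pi0_map_component//; apply/esym/eq_connected_component.
Qed.

Definition saturated_image {X Y : topologicalType} (f : X -> Y) (U : set X) :
    set Y :=
  [set y | exists2 x, U x & connected_component [set: Y] y (f x)].

(** A point outside is separated from each [f x] with [x] in [U] by a clopen
    set, hence from all of them at once, and then from their components. *)
Lemma saturated_image_closed {X Y : topologicalType} (f : X -> Y) (U : set X) :
  spectral Y -> continuous f -> compact U -> closed (saturated_image f U).
Proof.
move=> sY cf cU; rewrite -openC openE => y nVy.
have [Z [cZ Zy UZ]] : exists Z, [/\ clopen Z, Z y & forall x, U x -> ~ Z (f x)].
  apply: compact_clopen_avoid => // x Ux.
  by apply: not_connected_component_clopen => // yx; apply: nVy; exists x.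
apply: (filterS (P := Z)); last by apply: open_nbhs_nbhs; split=> //; exact: cZ.1.
move=> z Zz [x Ux zx]; apply: (UZ x Ux).
exact: component_sub_clopen cZ Zz _ zx.
Qed.

Theorem proposition4 (X Y : topologicalType) (f : X -> Y)
    (specX : spectral X) (specY : spectral Y) (cf : continuous f) :
  set_bij (@OC Y) (@OC X) (fun V : set Y => f @^-1` V) <->
  set_bij (@pi0 X) (@pi0 Y) (pi0_map f).
Proof.
have cX : compact [set: X] by case: specX.
rewrite pi0_map_bijP//; split=> [[_ inj surj]|[inj surj]].
  split=> [x x' fxx'|y].
    apply/connected_component_clopenP => // _ /surj[V cV <-] Vx.
    exact: component_sub_clopen cV Vx _ fxx'.
  apply: contrapT => ny.
  have [V [cV Vy VX]] :
      exists Z, [/\ clopen Z, Z y & forall x, [set: X] x -> ~ Z (f x)].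
    apply: compact_clopen_avoid => // x _.
    by apply: not_connected_component_clopen => // yx; apply: ny; exists x.
  (* [V] and the empty set have the same preimage. *)
  suff V0 : V = set0 by move: Vy; rewrite V0.
  apply: inj; rewrite ?inE//; first exact: clopen0.
  by apply/seteqP; split=> x // /VX; apply.
split.
- by move=> V cV; exact: preimage_clopen.
- have sub V W : clopen V -> clopen W -> f @^-1` V = f @^-1` W -> V `<=` W.
    move=> cV cW VW y Vy; have [x yx] := surj y.
    have fVx : (f @^-1` V) x by exact: component_sub_clopen cV Vy _ yx.
    apply: (component_sub_clopen W (f x) cW); first by rewrite VW in fVx.
    exact: connected_component_sym.
  move=> V W; rewrite !inE => cV cW VW.
  by apply/seteqP; split; apply: sub.
- (* The complement of [saturated_image f U] has the same form, hence both are
     closed. *)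
  move=> U cU; have closed_sat A : closed A -> closed (saturated_image f A).
    move=> clA; apply: saturated_image_closed => //.
    by rewrite -(setTI A); exact: compact_closedI.
  have satC : saturated_image f U = ~` saturated_image f (~` U).
    apply/seteqP; split=> y.
      move=> [x Ux yx] [x' nUx' yx']; apply: nUx'.
      apply: (component_sub_clopen U x cU Ux); apply: inj.
      exact: connected_component_trans (connected_component_sym yx) yx'.
    move=> ny; have [x yx] := surj y; exists x => //.
    by apply: contrapT => nUx; apply: ny; exists x.
  exists (saturated_image f U).
    split; last by apply: closed_sat; exact: cU.2.
    by rewrite satC openC; apply: closed_sat; rewrite closedC; exact: cU.1.
  apply/seteqP; split=> x.
    move=> [x' Ux' /inj xx']; apply: (component_sub_clopen U x' cU Ux').
    exact: connected_component_sym.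
  by exists x => //; exact: connected_component_refl.
Qed.
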